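(* Every additive subgroup $G$ of $\mathbb R$ (with the metric $|x-y|$) has the Lipschitz Clustering Property. Furthermore, for every interval $I\subset\mathbb R$ the intersection $G\cap I$ has the Lipschitz Clustering Property as well.
   Context: For a metric space $(X,d)$ and a positive integer $n$, $X(n)=\{A\subset X\colon 1\le |A|\le n\}$, equipped with the Hausdorff metric $\Delta(A,B)=\max\left(\sup_{a\in A}\operatorname{dist}(a,B),\ \sup_{b\in B}\operatorname{dist}(b,A)\right)$; $X(n-1)\subset X(n)$. $X$ has the Lipschitz Clustering Property (LCP) if for every integer $n\ge 2$ there exists a Lipschitz map $X(n)\to X(n-1)$ whose restriction to $X(n-1)$ is the identity (a Lipschitz retraction). Subsets of $\mathbb R$ carry the restriction of the metric $|x-y|$. *)

(* Defs.v *)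
From mathcomp Require Export all_boot all_order all_algebra.
From mathcomp Require Export all_classical all_reals all_analysis.
Export numFieldNormedType.Exports.
Import Order.TTheory GRing.Theory Num.Theory.

Set Implicit Arguments.
Unset Strict Implicit.
Unset Printing Implicit Defensive.

Local Open Scope classical_set_scope.
Local Open Scope card_scope.
Local Open Scope ring_scope.

(* A metric space is given as a subset X of an ambient metric space T, with the
   restricted metric (X = setT is the space T itself).  The distances below
   depend only on the ambient metric.  [sup] and [inf] are the real-valued
   ones: they have their usual meaning on X(n), where all sets are finite and
   nonempty. *)

Definition setdist (R : realType) (T : metricType R) (a : T) (B : set T) : R :=
  inf [set mdist a b | b in B].

Definition hausdorff_dist (R : realType) (T : metricType R) (A B : set T) : R :=
  Num.max (sup [set setdist a B | a in A]) (sup [set setdist b A | b in B]).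

(* X(n), the subsets A of X with 1 <= |A| <= n *)
Definition finsubsets (R : realType) (T : metricType R) (X : set T) (n : nat) :
    set (set T) :=
  [set A | A `<=` X /\ exists2 k, (1 <= k <= n)%N & A #= `I_k].

(* The values of r outside X(n) are irrelevant. *)
Definition lipschitz_retraction (R : realType) (T : metricType R) (X : set T)
    (n : nat) (r : set T -> set T) : Prop :=
  [/\ forall A, finsubsets X n A -> finsubsets X n.-1 (r A),
      forall A, finsubsets X n.-1 A -> r A = A
    & exists2 L : R, 0 <= L &
      forall A B, finsubsets X n A -> finsubsets X n B ->
        hausdorff_dist (r A) (r B) <= L * hausdorff_dist A B].

(* Lipschitz Clustering Property *)
Definition LCP (R : realType) (T : metricType R) (X : set T) : Prop :=
  forall n : nat, (2 <= n)%N -> exists r, lipschitz_retraction X n r.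

(* R^o is the real line with its usual metric. *)
Lemma mdist_realE (R : realType) (x y : R) : @mdist R R^o x y = `|x - y|.
Proof. exact: distrC. Qed.

(* Main.v *)
(* If A = {a_0 < ... < a_{n-1}} has n points and smallest gap d, send A to the set
   of the a_i - i d; sets with fewer points are fixed.  The smallest gap
   collapses, so the image has at most n - 1 points; d is a difference of elements
   of G, so the image stays in G; and a_0 <= a_i - i d <= a_i, so it stays in
   every interval containing A.  For the Lipschitz bound let c be the distance
   from A to B.  If the smallest gap of A exceeds 2 c, then B has n points too, the
   i-th points of A and B are at distance at most c, and all the quantities above
   vary by O(n c); likewise for B.  Otherwise each of A and B is moved by at most
   2 n c, whence the Lipschitz constant 4 n + 1. *)
Require Import Defs.
From mathcomp Require Import zify ring lra.
Import Order.TTheory GRing.Theory Num.Theory.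

Set Implicit Arguments.
Unset Strict Implicit.
Unset Printing Implicit Defensive.

Local Open Scope classical_set_scope.
Local Open Scope ring_scope.

(** * Hausdorff distance between finite nonempty sets *)

Section Hausdorff.
Variables (R : realType) (T : metricType R).
Implicit Types (A B : set T) (c : R).

Lemma finite_set_min (S : set R) :
  finite_set S -> S !=set0 -> exists2 m, S m & lbound S m.
Proof.
move=> /finite_seqP[s ->{S}] [x0 /= sx0].
elim: s x0 sx0 => [//|x [|y s] IH] x0 _.
  by exists x => [|z]; rewrite /= inE // => /eqP->.
have [m sm lm] := IH y (mem_head y s).
have [xm|mx] := leP x m.
  exists x => [|z]; first exact: mem_head.
  by rewrite /= inE => /orP[/eqP->//|/lm]; apply: le_trans.
exists m => [|z]; first by rewrite /= inE sm orbT.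
by rewrite /= inE => /orP[/eqP->|/lm//]; apply: ltW.
Qed.

Lemma finite_set_has_ubound (S : set R) : finite_set S -> has_ubound S.
Proof.
have [->|/set0P S0] := eqVneq S set0; first by move=> _; exists 0.
move=> Sfin; have [_ [y Sy <-] ym] : exists2 m, (-%R @` S) m & lbound (-%R @` S) m.
  apply: finite_set_min; first exact: finite_image.
  by case: S0 => x Sx; exists (- x), x.
by exists y => x Sx; rewrite -lerN2; apply: ym; exists x.
Qed.

(** One half of a bound on the Hausdorff distance, with a witness in place of [inf] and [sup]. Such
    bounds compose by the triangle inequality. *)
Definition within c A B := forall a, A a -> exists2 b, B b & mdist a b <= c.

(** The infimum over a finite nonempty set is attained, so even the non-strict bound yields a point
    of [B]. *)
Lemma setdist_leP (a : T) B c : finite_set B -> B !=set0 ->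
  setdist a B <= c <-> exists2 b, B b & mdist a b <= c.
Proof.
move=> Bfin [b0 Bb0].
have S0 : [set mdist a b | b in B] !=set0 by exists (mdist a b0), b0.
split=> [ac|[b Bb abc]].
  have [_ [b Bb <-] bm] := finite_set_min (finite_image _ Bfin) S0.
  by exists b => //; apply: le_trans ac; apply: lb_le_inf.
apply: le_trans abc; apply: ge_inf; last by exists b.
by exists 0 => _ [y _ <-]; exact: mdist_ge0.
Qed.

Lemma sup_setdist_leP A B c : finite_set A -> A !=set0 ->
    finite_set B -> B !=set0 ->
  sup [set setdist a B | a in A] <= c <-> within c A B.
Proof.
move=> Afin [a0 Aa0] Bfin B0; split=> [ABc a Aa|AB].
  apply/setdist_leP => //; apply: le_trans ABc; apply: ub_le_sup; last by exists a.
  by apply/finite_set_has_ubound/finite_image.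
apply: ge_sup; first by exists (setdist a0 B), a0.
by move=> _ [a Aa <-]; apply/setdist_leP => //; exact: AB.
Qed.

Lemma hausdorff_dist_leP A B c : finite_set A -> A !=set0 ->
    finite_set B -> B !=set0 ->
  hausdorff_dist A B <= c <-> within c A B /\ within c B A.
Proof.
move=> Afin A0 Bfin B0; rewrite /hausdorff_dist ge_max; split.
  by move=> /andP[? ?]; split; apply/sup_setdist_leP.
by move=> [? ?]; apply/andP; split; apply/sup_setdist_leP.
Qed.

Lemma within_trans c d A B C :
  within c A B -> within d B C -> within (c + d) A C.
Proof.
move=> AB BC a /AB[b /BC[e Ce be] ab]; exists e => //.
by apply: le_trans (metric_triangle a b e) _; apply: lerD.
Qed.

Lemma card_eq_seqP (A : set T) n :
  (A #= `I_n)%card <-> exists s : seq T, [/\ A = [set` s], uniq s & size s = n].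
Proof.
split=> [An|[s [-> us <-]]].
  exists (finmap.enum_fset (fset_set A)); split; last exact: card_fset_set.
    by rewrite fset_setK//; apply/finite_setP; exists n.
  exact: finmap.fset_uniq.
have sfin : finite_set [set` s] by apply/finite_seqP; exists s.
have [m sm] := (finite_setP _).1 sfin; rewrite (_ : size s = m)//.
rewrite -(card_fset_set sm); apply/perm_size/uniq_perm => //.
  exact: finmap.fset_uniq.
by move=> x; rewrite in_fset_set// mem_setE.
Qed.

Lemma finsubsets_finite (X A : set T) n :
  finsubsets X n A -> finite_set A /\ A !=set0.
Proof.
move=> [_ [k /andP[k0 _] /card_eq_seqP[[|x s] [-> _ sk]]]].
  by rewrite -sk in k0.
by split; [apply/finite_seqP; exists (x :: s) | exists x; exact: mem_head].
Qed.

End Hausdorff.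

(** * Increasing enumerations and the smallest gap *)

Section Cluster.
Variable R : realType.
Implicit Types (A B : set R) (a b : nat -> R) (n : nat).

(** Positivity of [d] makes [a] strictly increasing below [n]; the last clause makes [d] the
    attained minimum of the gaps, hence unique. Values of [a] from [n] on are arbitrary. *)
Definition enumerates n A a (d : R) :=
  [/\ A = a @` `I_n, 0 < d, forall i, (i.+1 < n)%N -> d <= a i.+1 - a i
    & exists2 i, (i.+1 < n)%N & a i.+1 - a i = d].

(** Telescoping over consecutive gaps. With [i = 0] it yields [a 0 <= a j - d *+ j]. *)
Lemma gap_ge n a d : (forall i, (i.+1 < n)%N -> d <= a i.+1 - a i) ->
  forall i j, (i <= j < n)%N -> d *+ (j - i) <= a j - a i.
Proof.
move=> ad i j /andP[/subnK<-]; elim: (j - i)%N => [|k IH] kn.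
  by rewrite add0n subnn subrr.
rewrite addnK addSn; have := ad _ kn; have := IH (ltnW kn).
by rewrite addnK mulrSr; lra.
Qed.

Lemma increasing_map_sorted n a :
  (forall i, (i.+1 < n)%N -> a i < a i.+1) -> sorted <%R (map a (iota 0 n)).
Proof.
move=> an; apply/(sortedP 0) => i; rewrite size_map size_iota => i1n.
rewrite !(nth_map 0%N) ?size_iota ?(ltnW i1n)// !nth_iota ?(ltnW i1n)//.
exact: an.
Qed.

Lemma map_iota_image n a : a @` `I_n = [set` map a (iota 0 n)].
Proof.
apply/seteqP; split=> [_ [i /= ni <-]|x /= /mapP[i]].
  by apply: map_f; rewrite mem_iota.
by rewrite mem_iota => /= ni ->; exists i.
Qed.

Lemma enumerates_sorted n A a d : enumerates n A a d ->
  sorted <%R (map a (iota 0 n)).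
Proof.
case=> _ d0 ad _; apply: increasing_map_sorted => i /ad; lra.
Qed.

Lemma enumerates_card n A a d : enumerates n A a d -> (A #= `I_n)%card.
Proof.
move=> E; apply/(@card_eq_seqP R R^o); exists (map a (iota 0 n)).
split; last by rewrite size_map size_iota.
  by case: E => -> _ _ _; exact: map_iota_image.
by apply: lt_sorted_uniq; exact: enumerates_sorted E.
Qed.

(** A strictly sorted list is determined by its members, and each of [d], [d'] is then an attained
    gap bounded below by the other. *)
Lemma enumerates_uniq n A a d a' d' :
  enumerates n A a d -> enumerates n A a' d' ->
  (forall i, (i < n)%N -> a i = a' i) /\ d = d'.
Proof.
move=> E E'; have aa' i : (i < n)%N -> a i = a' i.
  suff e : map a (iota 0 n) = map a' (iota 0 n).
    move=> ni; move: (congr1 (nth 0 ^~ i) e).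
    by rewrite !(nth_map 0%N) ?size_iota// nth_iota.
  apply: lt_sorted_eq (enumerates_sorted E) (enumerates_sorted E') _ => x.
  case: E => EA _ _ _; case: E' => EA' _ _ _.
  move: EA'; rewrite EA !map_iota_image => /seteqP[s1 s2].
  by apply/idP/idP => [/s1|/s2].
split=> //; case: E => _ _ ad [i ni ed]; case: E' => _ _ ad' [j nj ed'].
apply/eqP; rewrite eq_le -{2}ed -{1}ed'.
by rewrite aa'// aa' 1?ltnW// ad'// -aa'// -aa' 1?ltnW// ad.
Qed.

Lemma increasing_enumerates n A a : (1 < n)%N -> A = a @` `I_n ->
    (forall i, (i.+1 < n)%N -> a i < a i.+1) ->
  exists d, enumerates n A a d.
Proof.
move=> n1 An an.
have [|_ [i /= ni <-] dm] := @finite_set_min R _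
    (finite_image (fun i => a i.+1 - a i) (finite_II n.-1)).
  by exists (a 1%N - a 0%N), 0%N => //=; case: n n1 {An an} => [|[]].
have nE j : (j.+1 < n)%N = (j < n.-1)%N by case: (n).
exists (a i.+1 - a i); split=> //.
- by rewrite subr_gt0 an// nE.
- by move=> j; rewrite nE => nj; apply: dm; exists j.
- by exists i; rewrite ?nE.
Qed.

Lemma card_enumerates n A : (1 < n)%N -> (A #= `I_n)%card ->
  exists a d, enumerates n A a d.
Proof.
move=> n1 /(@card_eq_seqP R R^o)[s [-> us sn]].
set t := sort <=%R s; exists (nth 0 t); apply: increasing_enumerates => //.
  rewrite map_iota_image -sn -(size_sort <=%R) map_nth_iota0// take_size.
  by apply/seteqP; split=> x /=; rewrite mem_sort.
move=> i; rewrite -sn -(size_sort <=%R); move: i; apply/sortedP.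
by rewrite sort_lt_sorted.
Qed.

(** * The clustering map *)

(** The enumeration is picked by choice; by [enumerates_uniq] the result does not depend on the
    pick. *)
Definition cluster n A : set R :=
  if pselect (exists ad : (nat -> R) * R, enumerates n A ad.1 ad.2) is left e
  then let ad := projT1 (cid e) in [set ad.1 i - ad.2 *+ i | i in `I_n]
  else A.

Lemma clusterE n A a d : enumerates n A a d ->
  cluster n A = [set a i - d *+ i | i in `I_n].
Proof.
move=> E; rewrite /cluster; case: pselect => [e|]; last by case; exists (a, d).
case: (cid e) => -[a' d'] /= E'; have [aa' <-] := enumerates_uniq E E'.
by apply/seteqP; split=> _ [i /= ni <-]; exists i => //; rewrite aa'.
Qed.

Lemma cluster_id n A : ~ (A #= `I_n)%card -> cluster n A = A.
Proof.
move=> An; rewrite /cluster; case: pselect => // e.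
by case: An; case: e => ad /enumerates_card.
Qed.

Lemma cluster_within n A a d : enumerates n A a d ->
  @within R R^o (d *+ n) A (cluster n A) /\
  @within R R^o (d *+ n) (cluster n A) A.
Proof.
move=> E; rewrite (clusterE E); case: E => -> d0 _ _.
have le i : (i < n)%N -> d *+ i <= d *+ n.
  by move=> ni; apply: ler_wpMn2l; [exact: ltW|exact: ltnW].
split=> [_ [i /= ni <-]|_ [i /= ni <-]].
  exists (a i - d *+ i); first by exists i.
  by rewrite mdist_realE subKr ger0_norm ?le// mulrn_wge0// ltW.
exists (a i); first by exists i.
by rewrite mdist_realE distrC subKr ger0_norm ?le// mulrn_wge0// ltW.
Qed.

(** * Comparison of nearby sets *)

(* As the gaps of [A] exceed [2 c], points of [B] chosen near the [a i] increase
   with [i]; by cardinality they exhaust [B]. *)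
Lemma enumerates_near n A B a d c k : enumerates n A a d -> c *+ 2 < d ->
    (B #= `I_k)%card -> (k <= n)%N -> @within R R^o c A B ->
  exists b d', enumerates n B b d' /\ forall i, (i < n)%N -> `|a i - b i| <= c.
Proof.
case=> EA d0 ad [i0 ni0 _] cd /(@card_eq_seqP R R^o)[s [EB us sk]] kn AB.
have [b bP] : {b : nat -> R & forall i, (i < n)%N -> B (b i) /\ `|a i - b i| <= c}.
  apply: (@boolp.choice _ _ (fun i y => (i < n)%N -> B y /\ `|a i - y| <= c)).
  move=> i; have [ni|_] := boolP (i < n)%N; last by exists 0.
  have [|y By ay] := AB (a i); first by rewrite EA; exists i.
  by exists y => _; rewrite -mdist_realE.
have binc i : (i.+1 < n)%N -> b i < b i.+1.
  move=> ni; have := ad i ni; have [_] := bP _ ni; have [_] := bP _ (ltnW ni).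
  by rewrite !ler_norml => /andP[? ?] /andP[? ?]; lra.
have Bb : B = b @` `I_n.
  have us' := lt_sorted_uniq (increasing_map_sorted binc).
  have [||_ ss'] := @uniq_min_size _ _ s us'.
  - by move=> x /mapP[i]; rewrite mem_iota => /= ni ->; have [] := bP i ni; rewrite EB.
  - by rewrite size_map size_iota sk.
  by rewrite EB map_iota_image; apply/seteqP; split=> x /=; rewrite ss'.
have [|d' E'] := increasing_enumerates _ Bb binc.
  by apply: leq_ltn_trans ni0.
by exists b, d'; split=> // i /bP[].
Qed.

(** Where [a] attains its smallest gap, the corresponding gap of [b] differs from it by at most
    [2 c]. *)
Lemma enumerates_gap_le n A B a b d d' c :
    enumerates n A a d -> enumerates n B b d' ->
    (forall i, (i < n)%N -> `|a i - b i| <= c) ->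
  d' <= d + c *+ 2.
Proof.
move=> [_ _ _ [i ni <-]] [_ _ bd _] ab.
have := bd _ ni; have := ab _ ni; have := ab _ (ltnW ni).
by rewrite !ler_norml => /andP[? ?] /andP[? ?]; lra.
Qed.

Lemma cluster_near n A B a b d d' c :
    enumerates n A a d -> enumerates n B b d' ->
    (forall i, (i < n)%N -> `|a i - b i| <= c) -> 0 <= c ->
  @within R R^o (c *+ 2 *+ n + c) (cluster n A) (cluster n B).
Proof.
move=> E E' ab c0.
have dd' : `|d' - d| <= c *+ 2.
  rewrite ler_norml; apply/andP; split; last by have := enumerates_gap_le E E' ab; lra.
  suff : d <= d' + c *+ 2 by lra.
  by apply: (enumerates_gap_le E' E) => i /ab; rewrite distrC.
rewrite (clusterE E) (clusterE E') => _ [i /= ni <-].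
exists (b i - d' *+ i); first by exists i.
(* The change of gap is counted [i < n] times, the change of the point once. *)
rewrite mdist_realE (_ : _ - _ = (d' - d) *+ i + (a i - b i)); last first.
  by rewrite mulrnBl; ring.
apply: le_trans (ler_normD _ _) _; apply: lerD; last exact: ab.
rewrite normrMn; apply: (@le_trans _ _ (c *+ 2 *+ i)); first exact: ler_wMn2r.
by apply: ler_wpMn2l; [rewrite mulrn_wge0|exact: ltnW].
Qed.

(** The threshold [2 c] is the one [enumerates_near] requires. Below it each point moves by at most
    [d *+ n]; a set without exactly [n] points does not move. *)
Lemma cluster_displacement n A c : (1 < n)%N -> 0 <= c ->
  (exists a d, enumerates n A a d /\ c *+ 2 < d) \/
  @within R R^o (c *+ 2 *+ n) A (cluster n A) /\
  @within R R^o (c *+ 2 *+ n) (cluster n A) A.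
Proof.
move=> n1 c0; have cn0 : 0 <= c *+ 2 *+ n by rewrite !mulrn_wge0.
have [An|An] := pselect (A #= `I_n)%card; last first.
  by right; rewrite cluster_id//; split=> x Ax; exists x; rewrite ?mdistxx.
have [a [d E]] := card_enumerates n1 An.
have [cd|dc] := ltP (c *+ 2) d; first by left; exists a, d.
right; have dcn : d *+ n <= c *+ 2 *+ n by exact: ler_wMn2r.
by have [H1 H2] := cluster_within E; split=> x => [/H1|/H2] [y ? xy];
  exists y => //; exact: le_trans xy dcn.
Qed.

(** * The retraction and its Lipschitz constant *)

Lemma cluster_finsubsets (G : set R) (I : interval R) n A :
    zmod_closed (mem G) -> (1 < n)%N ->
  finsubsets (G `&` [set` I] : set R^o) n A ->
  finsubsets (G `&` [set` I] : set R^o) n.-1 (cluster n A).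
Proof.
move=> [_ GB] n1 [AX [k /andP[k0 kn] Ak]].
have [An|An] := pselect (A #= `I_n)%card; last first.
  rewrite cluster_id//; split=> //; exists k => //; rewrite k0/=.
  move: kn; rewrite leq_eqVlt => /predU1P[kn|]; last by case: (n) n1.
  by rewrite kn in Ak.
have [a [d E]] := card_enumerates n1 An.
rewrite (clusterE E); case: (E) => EA d0 ad [i0 ni0 ed].
have Xa i : (i < n)%N -> (G `&` [set` I]) (a i) by move=> ni; apply: AX; rewrite EA; exists i.
have GB' x y : G x -> G y -> G (x - y).
  by move=> Gx Gy; have := GB x y; rewrite !inE; apply.
(* The smallest gap is attained, so it is a difference of two points of [A]. *)
have Gd : G d by rewrite -ed; apply: GB'; [case: (Xa _ ni0)|case: (Xa _ (ltnW ni0))].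
have Gdn x i : G x -> G (x - d *+ i).
  move=> Gx; elim: i => [|i IH]; first by rewrite subr0.
  by rewrite mulrSr opprD addrA; exact: GB'.
split=> [_ [i /= ni <-]|].
  split; first by apply: Gdn; case: (Xa _ ni).
  have n0 : (0 < n)%N by exact: ltnW.
  (* The image of [a i] lies between [a 0] and [a i], and intervals are convex. *)
  apply: (@interval_is_interval _ I (a 0%N) (a i)); [by case: (Xa _ n0)|by case: (Xa _ ni)|].
  have := @gap_ge n a d ad 0 i; rewrite subn0 ni => /(_ isT).
  have := mulrn_wge0 i (ltW d0); lra.
pose b i := a i - d *+ i; rewrite -/(b @` _) map_iota_image.
(* The points [i0] and [i0.+1], which realize the smallest gap, have the same image, so the list of
   images has a repetition. *)
have lt_undup : (size (undup (map b (iota 0 n))) < n)%N.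
  rewrite -[X in (_ < X)%N](size_iota 0) -(size_map b) ltn_size_undup.
  apply/(uniqPn 0); exists i0, i0.+1; split=> //.
    by rewrite size_map size_iota.
  rewrite !(nth_map 0%N) ?size_iota ?(ltnW ni0)// !nth_iota ?(ltnW ni0)//.
  by rewrite /b !add0n mulrSr -ed; ring.
exists (size (undup (map b (iota 0 n)))).
  apply/andP; split; last by rewrite -ltnS (ltn_predK n1).
  rewrite lt0n size_eq0; apply/eqP => e.
  have : b 0%N \in undup (map b (iota 0 n)).
    by rewrite mem_undup; apply: map_f; rewrite mem_iota (ltnW n1).
  by rewrite e.
apply/(@card_eq_seqP R R^o); exists (undup (map b (iota 0 n))).
split=> //; last exact: undup_uniq.
by apply/seteqP; split=> x /=; rewrite mem_undup.
Qed.

Lemma LCP_subgroup_interval (G : set R) (I : interval R) :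
  zmod_closed (mem G) -> LCP (G `&` [set` I] : set R^o).
Proof.
move=> hG n n1; exists (cluster n); split.
- by move=> A; apply: cluster_finsubsets.
- move=> A [_ [k /andP[_ kn] Ak]]; apply: cluster_id => An.
  have : k = n by apply/card_eq_II; apply: card_eq_trans An; rewrite card_eq_sym.
  by move=> e; move: kn; rewrite e -ltnS prednK ?ltnn// ltnW.
exists (4 * n + 1)%:R => [//|A B XA XB].
have [Afin A0] := finsubsets_finite XA; have [Bfin B0] := finsubsets_finite XB.
have [rAfin rA0] := finsubsets_finite (cluster_finsubsets hG n1 XA).
have [rBfin rB0] := finsubsets_finite (cluster_finsubsets hG n1 XB).
set c := hausdorff_dist A B.
have [AB BA] : within c A B /\ within c B A by apply/hausdorff_dist_leP.
have c0 : 0 <= c.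
  by case: A0 => x /AB[y _]; apply: le_trans; exact: mdist_ge0.
apply/hausdorff_dist_leP => //.
(* Stated for arbitrary [A'] and [B'] so as to serve whichever of the two sets has its smallest gap
   above [2 c]. *)
have near_case A' B' : finsubsets (G `&` [set` I] : set R^o) n B' ->
    @within R R^o c A' B' ->
    (exists a d, enumerates n A' a d /\ c *+ 2 < d) ->
  @within R R^o ((4 * n + 1)%:R * c) (cluster n A') (cluster n B') /\
  @within R R^o ((4 * n + 1)%:R * c) (cluster n B') (cluster n A').
  move=> [_ [k /andP[_ kn] Bk]] AB' [a [d [E cd]]].
  have [b [d' [E' ab]]] := enumerates_near E cd Bk kn AB'.
  have ba i : (i < n)%N -> `|b i - a i| <= c by move=> /ab; rewrite distrC.
  have le : c *+ 2 *+ n + c <= (4 * n + 1)%:R * c.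
    rewrite -mulrnA -mulrSr mulr_natl addn1; apply: ler_wpMn2l => //.
    by rewrite ltnS leq_mul2r orbT.
  have H1 := cluster_near E E' ab c0; have H2 := cluster_near E' E ba c0.
  by split=> x => [/H1|/H2] [y ? xy]; exists y => //; exact: le_trans xy le.
have [/near_case|[A1 A2]] := cluster_displacement A n1 c0; first exact.
have [/near_case H|[B1 B2]] := cluster_displacement B n1 c0.
  by have [] := H A XA BA.
(* Neither set moves by more than [2 n c]: go back from one image, cross by [c], move to the other
   image. *)
have e : (4 * n + 1)%:R * c = c *+ 2 *+ n + (c + c *+ 2 *+ n).
  by rewrite mulr_natl -!mulrnA -mulrS -mulrnDr; congr (_ *+ _); lia.
by rewrite e; split; [apply: within_trans A2 (within_trans AB B1)|
  apply: within_trans B2 (within_trans BA A1)].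
Qed.

End Cluster.

Theorem corollary4p3 (R : realType) (G : set R) (hG : zmod_closed (mem G)) :
  LCP (G : set R^o) /\
  forall I : interval R, LCP (G `&` [set` I] : set R^o).
Proof.
split=> [|I]; last exact: LCP_subgroup_interval.
(* The group itself is its intersection with the whole line. *)
have := LCP_subgroup_interval `]-oo, +oo[ hG.
by rewrite set_itvNyy setIT.
Qed.
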